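(* Let $G=(V,E)$ be a finite, undirected, unweighted, 2-vertex-connected graph with $n=|V|$ vertices. If $G$ has a depth-first-search spanning tree with at most $k$ leaves, then $G$ has a TSP tour of length at most $4n/3+2k/3$.
   Context: A depth-first-search (DFS) spanning tree of $G$ is a rooted spanning tree produced by a depth-first search of $G$ from some root; equivalently, a rooted spanning tree such that every edge of $G$ not in the tree joins a vertex to one of its ancestors. A TSP tour of $G$ is a closed walk in $G$ that visits every vertex at least once; its length is the number of edges traversed, counted with multiplicity. *)

(* Defs.v *)
From mathcomp Require Import all_boot.
Set Implicit Arguments. Unset Strict Implicit. Unset Printing Implicit Defensive.

Definition simple_graph (T : finType) (e : rel T) : Prop :=
  irreflexive e /\ symmetric e.

Definition del_vertex (T : finType) (e : rel T) (x : T) : rel T :=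
  [rel a b | [&& e a b, a != x & b != x]].

Definition two_vertex_connected (T : finType) (e : rel T) : Prop :=
  2 < #|T| /\
  (forall u w : T, connect e u w) /\
  (forall x u w : T, u != x -> w != x -> connect (del_vertex e x) u w).

Definition ancestor (T : finType) (par : T -> T) (u v : T) : Prop :=
  exists k, iter k par v = u.

(* (r, par) is a rooted spanning tree of the graph: par r = r, every
   non-root vertex is joined by a graph edge to its parent, and every vertex
   reaches the root by following parents (so the tree is acyclic and spans). *)
Definition rooted_spanning_tree (T : finType) (e : rel T) (r : T) (par : T -> T)
  : Prop :=
  par r = r /\
  (forall v, v != r -> e v (par v)) /\
  (forall v, ancestor par r v).

Definition dfs_tree (T : finType) (e : rel T) (r : T) (par : T -> T) : Prop :=
  rooted_spanning_tree e r par /\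
  (forall u v, e u v -> ancestor par u v \/ ancestor par v u).

Definition leaves (T : finType) (r : T) (par : T -> T) : {set T} :=
  [set v | [forall w, (w != r) ==> (par w != v)]].

(* A closed walk x0, x1, ..., xm = x0 is encoded as x0 :: p with path e x0 p
   and last x0 p = x0; its length (number of traversed edges) is size p.
   It is a TSP tour if it visits every vertex. *)
Definition tsp_tour (T : finType) (e : rel T) (x0 : T) (p : seq T) : Prop :=
  [/\ path e x0 p, last x0 p = x0 & forall v : T, v \in x0 :: p].

(* Main.v *)
Require Import Defs.
From mathcomp Require Import all_boot zify.
Set Implicit Arguments. Unset Strict Implicit. Unset Printing Implicit Defensive.

(** Choose a minimal set of back edges ("ears") such that every tree edge
    below the top one is bypassed strictly above its upper end.  Pair an ear
    that ends at [par z], on the branch of [z], with the tree edge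
    [z -- par z]: if the ear is used, that tree edge may be dropped.  Ears
    competing for the same tree edge own incomparable private tree edges, and a
    descent through these shows that all but at most [k] ears can be paired.

    An even subgraph [F] of tree and ears then yields a connected even
    multigraph, hence a tour, of length
      (n - 1) + #(tree edges not in F) + #(unpaired ears in F).
    That some [F] makes this at most (n - 1) + (n - 1 + 2k) / 3 is the statement
    that in a bridgeless graph the constant vector 1/3 lies in the polytope of
    complements of even subgraphs.  This follows from the Edmonds-Johnson
    theorem on minimum T-joins, proved as by Sebo: among all J that are T-joins
    up to two vertices s, t take the cheapest one; the zero-weight component U
    of t is T-odd, and lowering the weights on its cut by one lowers the minimum
    T-join weight by exactly one. *)

(** * Boundaries and cuts of multigraphs *)

Definition symdiff (I : finType) (A B : {set I}) : {set I} :=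
  [set i | (i \in A) (+) (i \in B)].

Notation "A :+: B" := (symdiff A B) (at level 52, left associativity).

Lemma in_symdiff (I : finType) (A B : {set I}) i :
  (i \in A :+: B) = (i \in A) (+) (i \in B).
Proof. by rewrite inE. Qed.

Lemma odd_card (I : finType) (A : {set I}) :
  odd #|A| = \big[addb/false]_(i in A) true.
Proof. by rewrite -sum1_card (big_morph odd oddD (erefl _)). Qed.

Lemma sum_symdiff (I : finType) (w : I -> nat) (A B : {set I}) :
  \sum_(i in A :+: B) w i + 2 * \sum_(i in A :&: B) w i =
  \sum_(i in A) w i + \sum_(i in B) w i.
Proof.
rewrite [\sum_(i in A :+: B) _]big_mkcond [\sum_(i in A :&: B) _]big_mkcond.
rewrite [\sum_(i in A) _]big_mkcond [\sum_(i in B) _]big_mkcond /=.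
rewrite big_distrr -!big_split /=; apply: eq_bigr => i _.
by rewrite in_symdiff inE; case: (i \in A); case: (i \in B) => /=; lia.
Qed.

Section Multigraph.
Variables (V E : finType) (a b : E -> V).

Definition incident (e : E) (q : V) : bool := (a e == q) (+) (b e == q).

Definition boundary (A : {set E}) : {set V} :=
  [set q | \big[addb/false]_(e in A) incident e q].

Definition cut (U : {set V}) : {set E} := [set e | (a e \in U) (+) (b e \in U)].

Lemma boundary0 : boundary set0 = set0.
Proof. by apply/setP=> q; rewrite !inE big_set0. Qed.

Lemma boundary_symdiff A B : boundary (A :+: B) = boundary A :+: boundary B.
Proof.
apply/setP=> q; rewrite !inE !(big_mkcond (fun e => e \in _)) -big_split /=.
apply: eq_bigr => e _; rewrite in_symdiff.
by case: (e \in A); case: (e \in B); case: (incident e q).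
Qed.

Lemma boundary1 e : boundary [set e] = [set a e] :+: [set b e].
Proof. by apply/setP=> q; rewrite !inE big_set1 /incident ![q == _]eq_sym. Qed.

(** Degrees are summed over [U]: an edge inside [U] counts twice, an edge across its cut once. *)
Lemma odd_cut A U : odd #|A :&: cut U| = odd #|U :&: boundary A|.
Proof.
have cardE (I : finType) (C D : {set I}) :
    odd #|C :&: D| = \big[addb/false]_(i in C) (i \in D).
  rewrite odd_card big_mkcond [RHS]big_mkcond /=; apply: eq_bigr => i _.
  by rewrite inE; case: (i \in C); case: (i \in D).
rewrite !cardE (eq_bigr (fun q => \big[addb/false]_(e in A) incident e q));
  last by move=> q _; rewrite inE.
rewrite exchange_big /=; apply: eq_bigr => e _; rewrite inE /incident big_split.
have bigE v : \big[addb/false]_(q in U) (v == q) = (v \in U).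
  case vU: (v \in U); last first.
    by apply: big1 => q qU; apply/eqP=> vq; rewrite vq qU in vU.
  rewrite (bigD1 v) //= eqxx big1 // => q /andP[_]; by rewrite eq_sym => /negPf.
by rewrite /= !bigE.
Qed.

(* Follow edges of [A] greedily from [s], an odd-degree vertex. *)
Lemma join_from A s : s \in boundary A ->
  exists (t : V) (B : {set E}), [/\ t \in boundary A, t != s, B \subset A &
                  boundary B = [set s] :+: [set t]].
Proof.
elim: {A}_.+1 {-2}A s (ltnSn #|A|) => // n IH A s ltAn sA.
have [e eA /orP es] : exists2 e, e \in A &
    (a e == s) && (b e != s) || (b e == s) && (a e != s).
  apply/exists_inP; apply/contraT; rewrite negb_exists_in => /forall_inP none.
  move: sA; rewrite inE big1 // => e eA; move: (none e eA); rewrite /incident.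
  by case: (a e == s); case: (b e == s).
have [y [ys bde]] : exists y, y != s /\ boundary [set e] = [set s] :+: [set y].
  case: es => /andP[/eqP <- ns].
    by exists (b e); split=> //; exact: boundary1.
  exists (a e); split=> //; rewrite boundary1; apply/setP=> q; by rewrite !inE addbC.
have [yA|yA] := boolP (y \in boundary A).
  by exists y, [set e]; rewrite yA ys sub1set eA.
have eAe : A :\ e = A :+: [set e].
  by apply/setP=> f; rewrite !inE; case: eqP => [->|]; rewrite ?eA ?addbF.
have bdE : boundary (A :\ e) = boundary A :+: ([set s] :+: [set y]).
  by rewrite eAe boundary_symdiff bde.
have y_in : y \in boundary (A :\ e).
  by rewrite bdE !(in_symdiff, in_set1) (negPf yA) eqxx (negPf ys).
have ltn1 : #|A :\ e| < n by rewrite (cardsD1 e A) eA in ltAn.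
have [t [B [tA ty BA bdB]]] := IH _ _ ltn1 y_in.
move: tA; rewrite bdE !(in_symdiff, in_set1) (negPf ty) addbF => tA.
have ts : t != s.
  by apply/eqP=> ts; move: tA; rewrite ts sA eqxx.
rewrite (negPf ts) addbF in tA.
exists t, (B :+: [set e]); split=> //.
  apply/subsetP=> f; rewrite !inE; case: eqP => [->|_]; first by rewrite eA.
  by rewrite addbF => /(subsetP BA); rewrite !inE => /andP[].
rewrite boundary_symdiff bdB bde; apply/setP=> q; rewrite !(in_symdiff, in_set1).
by case: (q == y); case: (q == t); case: (q == s).
Qed.

(** If the join from [y1] ends at [s], deleting it leaves neither [y1] nor [s] odd, so a second
    join, started at [y2], ends elsewhere. *)
Lemma join_avoiding A s : 1 < #|boundary A :\ s| ->
  exists (y z : V) (B : {set E}), [/\ y \in boundary A, z \in boundary A, y != z, y != s &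
     z != s] /\ B \subset A /\ boundary B = [set y] :+: [set z].
Proof.
case/card_gt1P=> y1 [y2 []]; rewrite !inE -/(y1 \in _) -/(y2 \in _).
move=> /andP[y1s y1A] /andP[y2s y2A] y12.
have y1A' : y1 \in boundary A by rewrite inE.
have y2A' : y2 \in boundary A by rewrite inE.
have [t [B [tA ty BA bdB]]] := join_from y1A'.
have [ts|ts] := eqVneq t s; last first.
  by exists y1, t, B; rewrite y1A' tA y1s ts BA bdB eq_sym ty.
have bdE : boundary (A :\: B) = boundary A :+: ([set y1] :+: [set s]).
  have -> : A :\: B = A :+: B.
    apply/setP=> f; rewrite !inE; case fB: (f \in B); last by rewrite addbF.
    by rewrite (subsetP BA).
  by rewrite boundary_symdiff bdB ts.
have y2' : y2 \in boundary (A :\: B).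
  by rewrite bdE !(in_symdiff, in_set1) y2A' (negPf y2s) eq_sym (negPf y12).
have [u [C [uA uy CA bdC]]] := join_from y2'.
have sA : s \in boundary A by rewrite -ts.
move: uA; rewrite bdE !(in_symdiff, in_set1).
have [->|us] := eqVneq u s.
  by rewrite sA [s == y1]eq_sym (negPf y1s).
have [->|u1] := eqVneq u y1; first by rewrite y1A'.
rewrite /= addbF => uA; exists y2, u, C; rewrite y2A' uA y2s us eq_sym uy bdC.
by split=> //; split=> //; apply: subset_trans CA _; apply: subsetDl.
Qed.

End Multigraph.

(** * Minimum T-joins *)

Ltac symdiff_eq :=
  apply/setP=> ?; rewrite !(in_symdiff, in_set1, in_set0);
  repeat match goal with
  | |- context [?x == ?y] => case: (x == y)
  | |- context [?x \in ?A] => case: (x \in A)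
  end; reflexivity.

Section CheapCut.
Variables (V E : finType) (a b : E -> V) (w : E -> nat) (p : V -> bool).
Hypothesis w_parity : forall e, odd (w e) = p (a e) (+) p (b e).
Notation bd := (boundary a b).
Notation cutU := (cut a b).
Notation wt A := (\sum_(e in A) w e).

(** Modulo 2, [w] is the indicator of the cut across which [p] changes, and a cycle meets every cut
    evenly. *)
Lemma even_weight_cycle C : bd C = set0 -> odd (wt C) = false.
Proof.
move=> bdC; have := odd_cut a b C [set v | p v].
rewrite bdC setI0 cards0 /= => cutC; apply: etrans cutC.
rewrite odd_card (big_morph odd oddD (erefl _)) big_mkcond [RHS]big_mkcond /=.
by apply: eq_bigr => e _; rewrite !inE w_parity; case: (e \in C); case: addb.
Qed.

Lemma weight_symdiff0 (A Z : {set E}) : wt Z = 0 -> wt (A :+: Z) = wt A.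
Proof.
move=> Z0; have := sum_symdiff w A Z; rewrite Z0 addn0.
rewrite [\sum_(i in A :&: Z) _]big1 ?muln0 ?addn0 // => i; rewrite inE => /andP[_ iZ].
by apply/eqP; move/eqP: Z0; rewrite sum_nat_eq0 => /forall_inP/(_ _ iZ).
Qed.

Lemma weight_symdiff1 (A : {set E}) e : e \in A -> wt (A :+: [set e]) + w e = wt A.
Proof.
move=> eA; rewrite (big_setD1 e eA) addnC; congr (_ + _); apply: eq_bigl => f.
by rewrite !inE; case: eqP => [->|]; rewrite ?eA // addbF.
Qed.

Definition zero_adj (u v : V) := [exists e, (w e == 0) &&
  ((a e == u) && (b e == v) || (a e == v) && (b e == u))].

Definition zero_component (t : V) : {set V} := [set v | connect zero_adj t v].

(** A path of weight-zero edges: it moves an odd vertex within the component of [t] at no cost. *)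
Lemma zero_join t u : u \in zero_component t ->
  exists2 Z : {set E}, wt Z = 0 & bd Z = [set t] :+: [set u].
Proof.
rewrite inE => /connectP[q pq ->] {u}; elim: q t pq => [|x q IH] t /=.
  by exists set0; rewrite ?big_set0 // boundary0; apply/setP=> y; rewrite !inE addbb.
case/andP=> /existsP[e /andP[/eqP we ete]] /IH[Z Z0 bdZ].
exists (Z :+: [set e]); first by rewrite weight_symdiff0 // big_set1.
rewrite boundary_symdiff bdZ boundary1; apply/setP=> y.
case/orP: ete => /andP[/eqP-> /eqP->]; rewrite !inE;
  by case: (y == t); case: (y == x); case: (_ == _).
Qed.

Lemma cut_zero_component t e : e \in cutU (zero_component t) -> 0 < w e.
Proof.
rewrite !inE lt0n; apply: contraTneq => we.
have adj x y : (a e == x) && (b e == y) || (a e == y) && (b e == x) -> zero_adj x y.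
  by move=> xy; apply/existsP; exists e; rewrite we eqxx.
have -> : connect zero_adj t (b e) = connect zero_adj t (a e); last by rewrite addbb.
by apply/idP/idP => h; apply: connect_trans h (connect1 (adj _ _ _)); rewrite !eqxx ?orbT.
Qed.

(** * Edges crossing a contracted vertex set *)

Section Outer.
Variable U : {set V}.
Definition inner_end e := if a e \in U then a e else b e.
Definition outer_end e := if a e \in U then b e else a e.

Lemma cut_ends e : e \in cutU U -> [/\ inner_end e \in U, outer_end e \notin U &
  bd [set e] = [set inner_end e] :+: [set outer_end e]].
Proof.
rewrite inE boundary1 /inner_end /outer_end; case: ifPn => /= [aU bU|aU bU]; split=> //.
by apply/setP=> q; rewrite !inE addbC.
Qed.

Lemma boundary_outside A q : q \notin U ->
  (q \in bd A) = (q \in bd [set e in A | (a e \notin U) && (b e \notin U)]) (+)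
    \big[addb/false]_(e in A :&: cutU U) (outer_end e == q).
Proof.
move=> qU; rewrite !inE !(big_mkcond (fun e => e \in _)) /= -big_split /=.
apply: eq_bigr => e _; rewrite !inE /outer_end /incident.
case: (e \in A) => //=; case aU: (a e \in U); case bU: (b e \in U) => //=;
  rewrite ?addbF //.
- by case: eqP => [aq|_]; [rewrite -aq aU in qU|case: eqP => // bq; rewrite -bq bU in qU].
- by case: eqP => [aq|_]; [rewrite -aq aU in qU|].
- by case: (b e =P q) => [bq|_]; [rewrite -bq bU in qU|rewrite addbF].
Qed.

(* A cycle of the graph with [U] contracted that passes exactly once through
   the contracted vertex. *)
Lemma contracted_cycle A s : s \notin U -> 2 < #|A :&: cutU U| ->
  (forall q, q \notin U -> (q \in bd A) = (q == s)) ->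
  exists (e f : E) (B : {set E}), [/\ e \in A :&: cutU U, f \in A :&: cutU U, e != f,
     B \subset A :\: cutU U & bd B = [set outer_end e] :+: [set outer_end f]].
Proof.
move=> sU cA bdA; set D := A :&: cutU U in cA *.
(* Two cut edges with a common outer end close up at once. Otherwise the odd vertices of the part of
   [A] outside [U] are the outer ends, toggled at [s]; at least three cut edges leave two of them
   besides [s]. *)
have [/dinjectiveP inj | /dinjectivePn[e eD [f]]] := boolP (dinjectiveb outer_end (mem D));
  last first.
  rewrite inE /= => /andP[nef fD] eqef; exists e, f, set0; split=> //.
  - by rewrite eq_sym.
  - exact: sub0set.
  - by rewrite boundary0 eqef; apply/setP=> q; rewrite !inE addbb.
set Ao := [set e in A | (a e \notin U) && (b e \notin U)].
have AoE : bd Ao = (outer_end @: D) :+: [set s].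
  apply/setP=> q; rewrite in_symdiff in_set1; have [qU|qU] := boolP (q \in U).
    have -> : (q == s) = false by apply/eqP=> qs; rewrite -qs qU in sU.
    rewrite addbF inE big1 => [|e]; last first.
      rewrite inE => /and3P[_ aU bU]; rewrite /incident.
      by case: eqP => [aq|_]; [rewrite aq qU in aU|case: eqP => // bq; rewrite bq qU in bU].
    apply/esym/negP=> /imsetP[e]; rewrite inE => /andP[_ /cut_ends[_ eU _]] qe.
    by rewrite -qe qU in eU.
  have := boundary_outside A qU; rewrite bdA // -/Ao -/D => ->.
  suff -> : \big[addb/false]_(e in D) (outer_end e == q) = (q \in outer_end @: D).
    by case: (_ \in _); case: (_ \in _).
  case: imsetP => [[e eD ->]|none].
    rewrite (bigD1 e) //= eqxx big1 // => f /andP[fD /negPf nfe].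
    by apply/eqP=> /(inj _ _ fD eD)/eqP; rewrite nfe.
  by apply: big1 => e eD; apply/eqP=> qe; case: none; exists e.
have card2 : 1 < #|bd Ao :\ s|.
  have -> : bd Ao :\ s = (outer_end @: D) :\ s.
    by rewrite AoE; apply/setP=> q; rewrite !inE; case: eqP; rewrite //= addbF.
  have := cardsD1 s (outer_end @: D); rewrite card_in_imset //; lia.
have [y [z [B [[yA zA yz ys zs] [BA bdB]]]]] := join_avoiding card2.
move: yA zA; rewrite AoE !in_symdiff !in_set1 (negPf ys) (negPf zs) !addbF.
case/imsetP=> e eD ye; case/imsetP=> f fD zf.
exists e, f, B; rewrite eD fD bdB ye zf; split=> //.
  by apply: contraNneq yz => ef; rewrite ye zf ef.
apply: subset_trans BA _; apply/subsetP=> g; rewrite !inE.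
by case/and3P=> -> /negPf-> /negPf->.
Qed.

End Outer.
(* [J] is a minimum [T]-join and [K] a minimum join among those with boundary
   [T] up to two vertices, here [s] and [t].  Extremality of [K] makes the cut
   of [U] cheap: a [T]-join meeting it in [2 i + 1] edges has at least [2 i] more
   weight than [J]. *)
Section Extremal.
Variables (T : {set V}) (J K : {set E}) (s t : V).
Hypothesis bdK : bd K = T :+: ([set s] :+: [set t]).
Hypothesis minK : forall A x y, bd A = T :+: ([set x] :+: [set y]) -> wt K <= wt A.
Hypothesis minJ : forall A, bd A = T -> wt J <= wt A.
Hypothesis ltKJ : wt K < wt J.
Let U := zero_component t.

Let tU : t \in U. Proof. by rewrite inE. Qed.

(** Otherwise a free path from [t] to [s] would turn [K] into a [T]-join lighter than [J]. *)
Let sU : s \notin U.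
Proof.
apply/negP=> /zero_join[Z Z0 bdZ]; suff /minJ : bd (K :+: Z) = T.
  by rewrite weight_symdiff0 // leqNgt ltKJ.
rewrite boundary_symdiff bdK bdZ; symdiff_eq.
Qed.

(** Dropping a cut edge from [K] and moving [t] freely to its inner end would give a cheaper set of
    the same kind, with the outer end in place of [t]. *)
Lemma extremal_cut_disjoint : K :&: cutU U = set0.
Proof.
apply/setP=> e; rewrite !in_setI in_set0; apply/negP=> /andP[eK eU].
have [iU oU bde] := cut_ends eU.
have [Z Z0 bdZ] := zero_join iU.
have := weight_symdiff1 eK; have := cut_zero_component eU.
suff /minK : bd (K :+: [set e] :+: Z) = T :+: ([set s] :+: [set outer_end U e]).
  by rewrite weight_symdiff0 //; lia.
rewrite !boundary_symdiff bdK bde bdZ; symdiff_eq.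
Qed.

(** [K] misses the cut, so evenly many of its odd vertices lie in [U]; these are [U :&: T] toggled
    at [t], since [s] lies outside. *)
Lemma extremal_cut_odd : odd #|U :&: T|.
Proof.
have := odd_cut a b K U; rewrite extremal_cut_disjoint cards0 bdK.
have -> : U :&: (T :+: ([set s] :+: [set t])) = (U :&: T) :+: [set t].
  apply/setP=> q; rewrite !(in_symdiff, in_set1, in_setI).
  case: (q =P t) => [->|_]; first by rewrite tU (negPf (memPn sU _ tU)) // eq_sym; case: (t \in T).
  by case: (q =P s) => [->|_]; rewrite ?(negPf sU) ?addbF.
rewrite (cardsD1 t) !(in_symdiff, in_set1, in_setI) tU eqxx /=.
have -> : ((U :&: T) :+: [set t]) :\ t = (U :&: T) :\ t.
  by apply/setP=> q; rewrite !(in_symdiff, in_set1, in_setI, in_setD1); case: eqP; rewrite //= addbF.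
by rewrite (cardsD1 t (U :&: T)) in_setI tU !oddD !oddb; case: (t \in T); case: (odd #|_|).
Qed.

Lemma weight_exchange (A B C : {set E}) : C \subset A :+: B ->
  wt (A :+: C) + wt (B :+: C) = wt A + wt B.
Proof.
move=> /subsetP CAB; rewrite !(big_mkcond (fun e => e \in _)) -!big_split /=.
apply: eq_bigr => e _; have := CAB e; rewrite !in_symdiff.
by case: (e \in C) => [/(_ isT)|_]; case: (e \in A); case: (e \in B) => //=; lia.
Qed.

(** Induction on the number of cut edges. If there are three or more, exchange a cycle [C] of
    [J' :+: K], up to weight-zero edges, through two of them: the total weight of [J'] and [K] is
    kept and [K] gains at least 2, so [J'] loses at least 2 along with two cut edges. *)
Lemma extremal_cut_cheap J' : bd J' = T -> wt J + #|J' :&: cutU U| <= wt J' + 1.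
Proof.
elim: {J'}_.+1 {-2}J' (ltnSn #|J' :&: cutU U|) => // n IH J' ltJn bdJ'.
have [le1|gt1] := leqP #|J' :&: cutU U| 1; first by have := minJ bdJ'; lia.
have gt2 : 2 < #|J' :&: cutU U|.
  have := odd_cut a b J' U; rewrite bdJ' extremal_cut_odd => oddc.
  by rewrite ltn_neqAle gt1 andbT; apply: contraTneq oddc => <-.
set A := J' :+: K.
have AU : A :&: cutU U = J' :&: cutU U.
  apply/setP=> e; rewrite !in_setI in_symdiff; case eU: (e \in cutU U); rewrite ?andbF //.
  have /setP/(_ e) := extremal_cut_disjoint; rewrite in_setI eU in_set0 !andbT => ->.
  by rewrite addbF.
have bdA q : q \notin U -> (q \in bd A) = (q == s).
  move=> qU; rewrite boundary_symdiff bdJ' bdK !(in_symdiff, in_set1).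
  have -> : (q == t) = false by apply: contraNF qU => /eqP->.
  by case: (q \in T); case: (q == s).
rewrite -AU in gt2.
have [e [f [B [eA fA nef BA bdB]]]] := contracted_cycle sU gt2 bdA.
have [eA' eU] := setIP eA; have [fA' fU] := setIP fA.
have [ieU oeU bde] := cut_ends eU; have [ifU ofU bdf] := cut_ends fU.
have [Ze Ze0 bdZe] := zero_join ieU; have [Zf Zf0 bdZf] := zero_join ifU.
have noB g : g \in cutU U -> g \in B = false.
  by move=> gU; apply: contraTF gU => /(subsetP BA); rewrite in_setD => /andP[].
have noZ (Z : {set E}) g : wt Z = 0 -> g \in cutU U -> g \in Z = false.
  move=> /eqP; rewrite sum_nat_eq0 => /forall_inP Z0 /cut_zero_component.
  by rewrite lt0n; apply: contraNF => /Z0.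
have [eJ fJ] : e \in J' /\ f \in J'.
  by move: eA fA; rewrite AU => /setIP[-> _] /setIP[-> _].
pose C := B :+: [set e] :+: [set f].
have CA : C \subset A.
  apply/subsetP=> g; rewrite [g \in C]in_symdiff in_symdiff !in_set1.
  case: (g =P e) => [-> _|_] //; case: (g =P f) => [-> _|_] //; rewrite !addbF.
  by move/(subsetP BA); rewrite in_setD => /andP[].
have eC : e \in C by rewrite !(in_symdiff, in_set1) noB // eqxx (negPf nef).
have eK : e \in K = false.
  by have /setP/(_ e) := extremal_cut_disjoint; rewrite in_setI eU in_set0 andbT.
have cycC : bd (C :+: Ze :+: Zf) = set0.
  rewrite !boundary_symdiff bdB bde bdf bdZe bdZf; symdiff_eq.
have evenC : odd (wt C) = false.
  by rewrite -(weight_symdiff0 C Ze0) -(weight_symdiff0 _ Zf0) even_weight_cycle.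
(* Opening the cycle [C] at [e] moves the end [t] of the near-join to the
   outer end of [e]; parity then turns the gain of 1 into 2. *)
have gain1 : wt K < wt (K :+: C).
  have eKC : e \in K :+: C by rewrite in_symdiff eK eC.
  have := weight_symdiff1 eKC; have := cut_zero_component eU.
  suff /minK : bd (K :+: C :+: [set e] :+: Zf) = T :+: ([set s] :+: [set outer_end U e]).
    by rewrite (weight_symdiff0 _ Zf0) => leK e0 <-; rewrite -addn1; exact: leq_add.
  rewrite !boundary_symdiff bdK bdB bde bdf bdZf; symdiff_eq.
have gain2 : wt K + 2 <= wt (K :+: C).
  have := congr1 odd (sum_symdiff w K C); rewrite mul2n !oddD odd_double evenC !addbF => par.
  by rewrite addn2 ltn_neqAle gain1 andbT; apply: contra_eqN par => /eqP <-; rewrite /=; case: odd.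
pose J2 := J' :+: C :+: Ze :+: Zf.
have wtJ2 : wt J2 = wt (J' :+: C).
  by rewrite (weight_symdiff0 _ Zf0) (weight_symdiff0 _ Ze0).
have bdJ2 : bd J2 = T.
  rewrite !boundary_symdiff bdJ' bdB bde bdf bdZe bdZf; symdiff_eq.
have cJ2 : #|J' :&: cutU U| = #|J2 :&: cutU U| + 2.
  have -> : J2 :&: cutU U = (J' :&: cutU U) :\ e :\ f.
    apply/setP=> g; rewrite !(in_setD1, in_setI, in_symdiff, in_set1).
    case gU: (g \in cutU U); rewrite ?andbF ?andbT // (noB _ gU) (noZ _ _ Ze0 gU) (noZ _ _ Zf0 gU) !addbF.
    case: (g =P e) => [->|_]; first by rewrite eJ (negPf nef) andbF.
    by case: (g =P f) => [->|_]; rewrite ?fJ ?addbF.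
  rewrite (cardsD1 e) [e \in _ :&: _]in_setI eJ eU (cardsD1 f (_ :\ e)) in_setD1 eq_sym nef.
  by rewrite in_setI fJ fU !add1n addn2.
have ltJ2 : #|J2 :&: cutU U| < n by rewrite cJ2 addn2 ltnS in ltJn; apply: ltnW.
move: (IH J2 ltJ2 bdJ2) (weight_exchange CA) gain2; rewrite wtJ2 cJ2.
by clear; lia.
Qed.

End Extremal.
End CheapCut.

(** Induction on total weight: lowering [w] by one on the cut of [U] lowers the minimum by at most
    one, and the right-hand side by the [c]-weight of an odd cut, which is at least 3. *)
Lemma cheap_join (V E : finType) (a b : E -> V) (c : E -> nat) (T : {set V}) :
  (forall U : {set V}, odd #|U :&: T| -> 3 <= \sum_(e in cut a b U) c e) ->
  (exists J, boundary a b J = T) ->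
  forall (w : E -> nat) (p : V -> bool),
  (forall e, odd (w e) = p (a e) (+) p (b e)) ->
  exists2 J, boundary a b J = T & 3 * \sum_(e in J) w e <= \sum_e c e * w e.
Proof.
move=> big_cut [J0 bdJ0] w.
elim: {w}_.+1 {-2}w (ltnSn (\sum_e w e)) => // n IH w ltwn p w_parity.
pose wt (A : {set E}) := \sum_(e in A) w e.
have [J /eqP bdJ minJ'] := arg_minnP (P := fun J => boundary a b J == T) wt (introT eqP bdJ0).
have minJ A : boundary a b A = T -> wt J <= wt A by move/eqP; apply: minJ'.
have [J_zero|J_pos] := posnP (wt J); first by exists J; rewrite // -/(wt J) J_zero.
pose near A := [exists s, exists t, boundary a b A == T :+: ([set s] :+: [set t])].
have [e eJ we] : exists2 e, e \in J & 0 < w e.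
  apply/exists_inP; apply: contraLR J_pos; rewrite negb_exists_in => /forall_inP none.
  rewrite -leqNgt leqn0 /wt sum_nat_eq0; apply/forall_inP=> e /none.
  by rewrite -eqn0Ngt.
have nearJe : near (J :+: [set e]).
  apply/existsP; exists (a e); apply/existsP; exists (b e).
  by rewrite boundary_symdiff bdJ boundary1.
have [K /existsP[s /existsP[t /eqP bdK]] minK'] := arg_minnP wt nearJe.
have minK A x y : boundary a b A = T :+: ([set x] :+: [set y]) -> wt K <= wt A.
  by move=> bdA; apply: minK'; apply/existsP; exists x; apply/existsP; exists y; apply/eqP.
(* Removing the positive edge [e] from [J] already gives a strictly lighter competitor of [K]. *)
have ltKJ : wt K < wt J.
  have leK := minK' _ nearJe; rewrite /wt -(weight_symdiff1 w eJ) -addn1.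
  exact: leq_add.
set U := zero_component a b w t.
have pos_cut f : f \in cut a b U -> 0 < w f by apply: cut_zero_component.
pose w' f := w f - (f \in cut a b U).
have w'E f : w f = w' f + (f \in cut a b U).
  by rewrite /w'; case: (boolP (f \in _)) => [/pos_cut ?|_]; rewrite ?subnK // subn0 addn0.
have oddU := extremal_cut_odd bdK minK minJ ltKJ.
have cheap := extremal_cut_cheap w_parity bdK minK minJ ltKJ.
have sum_w' A : wt A = \sum_(f in A) w' f + #|A :&: cut a b U|.
  rewrite /wt (eq_bigr _ (fun f _ => w'E f)) big_split /= -sum1_card; congr (_ + _).
  rewrite [LHS]big_mkcond [RHS]big_mkcond; apply: eq_bigr => f _; rewrite in_setI.
  by case: (f \in A); case: (f \in cut _ _ _).
have cut_c := big_cut U oddU.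
have cut_n0 : 0 < #|cut a b U|.
  by rewrite card_gt0; apply/eqP=> cut0; rewrite cut0 big_set0 in cut_c.
(* [w'] differs from [w] in parity exactly on the cut, so the potential is flipped on [U]. *)
have [||J2 bdJ2 wJ2] := IH w' _ (fun v => p v (+) (v \in U)).
- have sumT (g : E -> nat) : \sum_(f in [set: E]) g f = \sum_f g f.
    by apply: eq_bigl => f; rewrite in_setT.
  have := sum_w' setT; rewrite setTI /wt !sumT => wE.
  by rewrite wE in ltwn; move: ltwn cut_n0; clear; lia.
- move=> f; move: (w_parity f); rewrite w'E oddD oddb inE.
  by case: (odd (w' f)); case: (a f \in U); case: (b f \in U); case: (p (a f)); case: (p (b f)).
exists J; rewrite // -/(wt J).
have -> : \sum_f c f * w f = \sum_f c f * w' f + \sum_(f in cut a b U) c f.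
  rewrite [X in _ + X]big_mkcond -big_split; apply: eq_bigr => f _ /=.
  by rewrite w'E mulnDr; case: (f \in _); rewrite ?muln1 ?muln0.
move: (cheap J2 bdJ2) (sum_w' J2) wJ2 cut_c; rewrite -/U -/(wt J2) -/(wt J).
by clear; lia.
Qed.

(* Edges of [N] are penalised when used, the others when omitted. *)
Theorem heavy_even_subgraph (V E : finType) (a b : E -> V) (N : {set E}) (w : E -> nat) :
  (forall U : {set V}, #|cut a b U| != 1) ->
  exists2 F, boundary a b F = set0 &
    3 * (\sum_(e in ~: N :\: F) w e + \sum_(e in N :&: F) w e) <=
    \sum_(e in ~: N) w e + 2 * \sum_(e in N) w e.
Proof.
(* A relevant cut has an odd number of edges outside [N]; if only one, bridgelessness supplies an
   edge of [N], which counts 2. Hence the bound 3. *)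
move=> bridgeless; pose c e := if e \in N then 2 else 1.
have big_cut (U : {set V}) : odd #|U :&: boundary a b (~: N)| -> 3 <= \sum_(e in cut a b U) c e.
  rewrite -odd_cut => odd_cutN.
  have -> : \sum_(e in cut a b U) c e = #|cut a b U| + #|cut a b U :&: N|.
    rewrite -!sum1_card !(big_mkcond (fun e => e \in _)) -big_split /=.
    by apply: eq_bigr => e _; rewrite in_setI /c; case: (e \in N); case: (e \in _).
  have := bridgeless U; have := cardsID N (cut a b U).
  by move: odd_cutN; rewrite setIC -setDE; clear; lia.
(* Doubled weights are even, so a constant potential serves. *)
have [|//|J bdJ wJ] := cheap_join big_cut _ (w := fun e => (w e).*2) (p := fun=> false).
- by exists (~: N).
- by move=> e; rewrite odd_double.
(* [J] becomes the set of penalised edges. *)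
exists (J :+: ~: N); first by rewrite boundary_symdiff bdJ; apply/setP=> q; rewrite in_symdiff in_set0 addbb.
have -> : \sum_(e in ~: N :\: (J :+: ~: N)) w e + \sum_(e in N :&: (J :+: ~: N)) w e = \sum_(e in J) w e.
  rewrite !(big_mkcond (fun e => e \in _)) -big_split /=; apply: eq_bigr => e _.
  by rewrite !(in_setD, in_setI, in_setC, in_symdiff); case: (e \in N); case: (e \in J); rewrite /= ?addn0.
have cE : \sum_e c e * (w e).*2 = 2 * (\sum_(e in ~: N) w e + 2 * \sum_(e in N) w e).
  rewrite !(big_mkcond (fun e => e \in _)) mulnDr !big_distrr -big_split /=.
  by apply: eq_bigr => e _; rewrite in_setC /c; case: (e \in N) => /=; lia.
have dE : \sum_(e in J) (w e).*2 = 2 * \sum_(e in J) w e.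
  by rewrite big_distrr; apply: eq_bigr => e _; rewrite /= mul2n.
by move: wJ; rewrite cE dE; clear; lia.
Qed.

(** * Eulerian tours *)

Section Euler.
Variables (T : finType) (e : rel T).
Hypotheses (e_irr : irreflexive e) (e_sym : symmetric e).

Definition odd_degree (s : seq (T * T)) (q : T) : bool :=
  \big[addb/false]_(d <- s) ((d.1 == q) (+) (d.2 == q)).

Definition edge_seq (s : seq (T * T)) : bool := all (fun d => e d.1 d.2) s.

Definition seq_adj (s : seq (T * T)) : rel T := fun u v => ((u, v) \in s) || ((v, u) \in s).

Definition within (p : seq T) : pred (T * T) := fun d => (d.1 \in p) && (d.2 \in p).

Lemma odd_degree_cat s1 s2 q : odd_degree (s1 ++ s2) q = odd_degree s1 q (+) odd_degree s2 q.
Proof. exact: big_cat. Qed.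

Lemma odd_degree_perm s1 s2 q : perm_eq s1 s2 -> odd_degree s1 q = odd_degree s2 q.
Proof. exact: perm_big. Qed.

Lemma odd_degree_cons d s q :
  odd_degree (d :: s) q = (d.1 == q) (+) (d.2 == q) (+) odd_degree s q.
Proof. exact: big_cons. Qed.

Lemma sub_within p1 p2 s : {subset p1 <= p2} -> all (within p1) s -> all (within p2) s.
Proof.
by move=> sub12; apply: sub_all => d /andP[/sub12 d1 /sub12 d2]; apply/andP.
Qed.

(** After an edge from [x] to [z], the rest is odd exactly at [z] and [y], so the walk can continue
    until it reaches [y], leaving only even degrees. *)
Lemma greedy_walk s x y : edge_seq s -> x != y ->
  (forall q, odd_degree s q = (x == q) (+) (y == q)) ->
  exists p s1 s2, [/\ perm_eq s (s1 ++ s2), path e x p, last x p = y,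
    size p = size s1 & all (within (x :: p)) s1 /\ (forall q, odd_degree s2 q = false)].
Proof.
elim: {s}_.+1 {-2}s (ltnSn (size s)) x => // n IH s lts x es xy deg_s.
have [d ds dx] : exists2 d, d \in s & (d.1 == x) || (d.2 == x).
  apply/hasP; apply/contraT=> /hasPn none.
  have := deg_s x; rewrite eqxx eq_sym (negPf xy) /odd_degree big1_seq // => d /andP[_ /none].
  by rewrite negb_or => /andP[/negPf-> /negPf->].
have ed := allP es _ ds.
have [z [exz dE]] : exists z, e x z /\
    forall q, (d.1 == q) (+) (d.2 == q) = (x == q) (+) (z == q).
  case/orP: dx => /eqP <-; first by exists d.2.
  by exists d.1; rewrite e_sym; split=> // q; rewrite addbC.
have wd p : x \in p -> z \in p -> within p d.
  move=> xp zp; rewrite /within.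
  have dz v : (d.1 == v) || (d.2 == v) -> v \in p.
    move: (dE v); have [<- _ _ //|_] := eqVneq x v; have [<- _ _ //|_] := eqVneq z v.
    have : d.1 != d.2 by apply: contraTneq ed => ->; rewrite e_irr.
    by have [<-|_] := eqVneq d.1 v; [rewrite eq_sym => /negPf->|case: (_ == v)].
  by rewrite !dz ?eqxx ?orbT.
have ps : perm_eq s (d :: rem d s) by apply: perm_to_rem.
have [zy|zy] := eqVneq z y.
  exists [:: z], [:: d], (rem d s); split=> //=; first by rewrite exz.
  split=> [|q]; first by rewrite wd // !inE eqxx ?orbT.
  have := deg_s q; rewrite (odd_degree_perm q ps) odd_degree_cons dE zy.
  by case: (x == q); case: (y == q); case: odd_degree.
have es' : edge_seq (rem d s) by apply/allP=> f /mem_rem; apply: (allP es).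
have deg' q : odd_degree (rem d s) q = (z == q) (+) (y == q).
  have := deg_s q; rewrite (odd_degree_perm q ps) odd_degree_cons dE.
  by case: (x == q); case: (z == q); case: (y == q); case: odd_degree.
have lt' : size (rem d s) < n.
  by rewrite size_rem //; case: (s) ds lts.
have [p [s1 [s2 [ps' pp lp sp [wp deg2]]]]] := IH _ lt' z es' zy deg'.
exists (z :: p), (d :: s1), s2; split=> //=; rewrite ?exz ?sp //.
  by apply: perm_trans ps _; rewrite /= perm_cons.
split=> //; rewrite wd ?inE ?eqxx ?orbT //=; apply: sub_within wp => v.
by rewrite [in X in _ -> X]inE => ->; rewrite orbT.
Qed.

Lemma greedy_closed_walk s v : edge_seq s -> (forall q, odd_degree s q = false) ->
  (exists2 d, d \in s & (d.1 == v) || (d.2 == v)) ->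
  exists p s1 s2, [/\ perm_eq s (s1 ++ s2), path e v p, last v p = v,
    size p = size s1 /\ 0 < size s1 &
    all (within (v :: p)) s1 /\ (forall q, odd_degree s2 q = false)].
Proof.
move=> es deg_s [d ds dv].
have ed := allP es _ ds.
have ps : perm_eq s (d :: rem d s) by apply: perm_to_rem.
have es' : edge_seq (rem d s) by apply/allP=> f /mem_rem; apply: (allP es).
have [z [evz dE wd]] : exists z, [/\ e v z,
    forall q, (d.1 == q) (+) (d.2 == q) = (z == q) (+) (v == q) &
    forall p, v \in p -> z \in p -> within p d].
  case/orP: dv => /eqP <-.
    by exists d.2; split=> // [q|p vp zp]; [rewrite addbC|apply/andP].
  by exists d.1; rewrite e_sym; split=> // p vp zp; apply/andP.
have zv : z != v by apply: contraTneq evz => ->; rewrite e_irr.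
have deg' q : odd_degree (rem d s) q = (z == q) (+) (v == q).
  have := deg_s q; rewrite (odd_degree_perm q ps) odd_degree_cons dE.
  by case: (v == q); case: (z == q); case: odd_degree.
have [p [s1 [s2 [ps' pp lp sp [wp deg2]]]]] := greedy_walk es' zv deg'.
exists (z :: p), (d :: s1), s2; split=> //=; rewrite ?evz ?sp //.
  by apply: perm_trans ps _; rewrite /= perm_cons.
split=> //; rewrite wd ?inE ?eqxx ?orbT //=; apply: sub_within wp => u.
by rewrite [in X in _ -> X]inE => ->; rewrite orbT.
Qed.

(* Hierholzer's algorithm: splice closed walks until no edge is left. *)
Lemma euler_tour s r : edge_seq s -> (forall q, odd_degree s q = false) ->
  (forall v, connect (seq_adj s) r v) ->
  exists p, [/\ path e r p, last r p = r, size p = size s & forall v, v \in r :: p].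
Proof.
move=> es deg_s conn.
suff extend n p s1 s2 : size s2 < n -> perm_eq s (s1 ++ s2) -> path e r p -> last r p = r ->
    size p = size s1 -> all (within (r :: p)) s1 -> (forall q, odd_degree s1 q = false) ->
    exists p, [/\ path e r p, last r p = r, size p = size s & forall v, v \in r :: p].
  by apply: (extend _ [::] [::] s (ltnSn _)) => // q; rewrite /odd_degree big_nil.
elim: n p s1 s2 => // n IH p s1 s2 lts2 ps pp lp sp wp deg1.
have closed_all : ~~ has (fun d => (d.1 \in r :: p) || (d.2 \in r :: p)) s2 ->
    forall v, v \in r :: p.
  move=> /hasPn none v; have /connectP[q pq ->] := conn v.
  have in12 d : d \in s -> (d.1 \in r :: p) || (d.2 \in r :: p) -> within (r :: p) d.
    by rewrite (perm_mem ps) mem_cat => /orP[/(allP wp) //|/none/negPf->].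
  have : r \in r :: p by rewrite inE eqxx.
  move: pq; suff step x : path (seq_adj s) x q -> x \in r :: p -> last x q \in r :: p by exact: step.
  elim: q x => //= y q IHq x /andP[xy pq] xp; apply: IHq pq _.
  by case/orP: xy => /in12 /=; rewrite xp ?orbT => /(_ isT)/andP[].
have [/hasP[d ds2 dp]|no_touch] := boolP (has (fun d => (d.1 \in r :: p) || (d.2 \in r :: p)) s2);
  last first.
  exists p; split=> //; last exact: closed_all.
  suff s20 : s2 = [::] by rewrite (perm_size ps) s20 cats0.
  case: s2 {lts2 ps} no_touch closed_all => // d s2 no_touch /(_ no_touch) all_in.
  by move: no_touch; rewrite /= all_in.
have [v vp dv] : exists2 v, v \in r :: p & (d.1 == v) || (d.2 == v).
  by case/orP: dp => h; [exists d.1|exists d.2]; rewrite ?eqxx ?orbT.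
have es2 : edge_seq s2.
  by apply/allP=> f fs2; apply: (allP es); rewrite (perm_mem ps) mem_cat fs2 orbT.
have deg2 q : odd_degree s2 q = false.
  by have := deg_s q; rewrite (odd_degree_perm q ps) odd_degree_cat deg1.
have [|q [t1 [t2 [pt pq lq [sq t1_gt0] [wq deg_t2]]]]] := greedy_closed_walk (v := v) es2 deg2.
  by exists d.
have [p1 [p2 [pE lp1]]] : exists p1 p2, p = p1 ++ p2 /\ last r p1 = v.
  case/splitPl: vp => p1 p2 lp1; by exists p1, p2.
have deg_t1 x : odd_degree t1 x = false.
  by have := deg2 x; rewrite (odd_degree_perm x pt) odd_degree_cat deg_t2 addbF.
move: pp lp sp wp; rewrite pE cat_path last_cat lp1 => /andP[pp1 pp2] lp2 sp wp.
have subp : {subset r :: p1 ++ p2 <= r :: p1 ++ q ++ p2}.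
  by move=> x; rewrite !inE !mem_cat => /or3P[]->; rewrite ?orbT.
apply: (IH (p1 ++ q ++ p2) (s1 ++ t1) t2).
- have := perm_size pt; rewrite size_cat; move: lts2 t1_gt0; clear; lia.
- by rewrite -catA; apply: perm_trans ps _; rewrite perm_cat2l.
- by rewrite !cat_path lp1 pp1 pq lq.
- by rewrite !last_cat lp1 lq.
- by rewrite !size_cat sq -sp size_cat; clear; lia.
- rewrite all_cat (sub_within subp wp) /=; apply: sub_within wq => x.
  rewrite !inE !mem_cat => /orP[/eqP->|->]; last by rewrite !orbT.
  by rewrite -lp1; have := mem_last r p1; rewrite inE => /orP[->|->]; rewrite ?orbT.
- by move=> x; rewrite odd_degree_cat deg1 deg_t1.
Qed.
End Euler.

(** * Ears of a depth-first-search tree *)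

Section Tree.
Variables (T : finType) (r : T) (par : T -> T).
Hypotheses (par_root : par r = r) (root_anc : forall v, ancestor par r v).

Definition anc (u v : T) : bool := fconnect par v u.

Lemma ancP u v : reflect (ancestor par u v) (anc u v).
Proof.
apply: (iffP idP) => [uv|[k <-]]; last exact: fconnect_iter.
by exists (findex par v u); apply: iter_findex.
Qed.

Lemma anc_refl v : anc v v. Proof. exact: connect0. Qed.

Lemma anc_trans v u w : anc u v -> anc v w -> anc u w.
Proof. by move=> uv vw; apply: connect_trans vw uv. Qed.

Lemma anc_par v : anc (par v) v. Proof. exact: fconnect1. Qed.

Lemma anc_root v : anc r v. Proof. exact/ancP. Qed.

Lemma iter_par_root j : iter j par r = r.
Proof. by elim: j => //= j ->. Qed.

(** If [v] has period [j] and reaches [r] in [m] steps, then [m * j] steps both fix [v] and end at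
    [r]. *)
Lemma iter_par_fix j v : 0 < j -> iter j par v = v -> v = r.
Proof.
move=> j_gt0 jv; have [m mr] := root_anc v.
have jmv i : iter (i * j) par v = v by elim: i => // i IH; rewrite mulSn iterD IH.
rewrite -(jmv m) -[m * j](@subnK m); last by rewrite leq_pmulr.
by rewrite iterD mr iter_par_root.
Qed.

Lemma anc_anti u v : anc u v -> anc v u -> u = v.
Proof.
move=> /ancP[i iv] /ancP[j ju].
have [ij0|ij] := posnP (j + i).
  by move: ij0 iv => /eqP; rewrite addn_eq0 => /andP[_ /eqP->].
have vr : v = r by apply: (@iter_par_fix (j + i)); rewrite // iterD iv.
by rewrite -iv vr iter_par_root.
Qed.

Lemma par_neq v : v != r -> par v != v.
Proof. by apply: contraNneq => /(@iter_par_fix 1 v isT)/eqP. Qed.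

Lemma anc_of_root v : anc v r -> v = r.
Proof. by move=> vr; apply: anc_anti vr (anc_root _). Qed.

Lemma anc_proper u v : anc u v -> u != v -> anc u (par v).
Proof.
move=> /ancP[[|i] <-]; first by rewrite eqxx.
by rewrite iterSr => _; apply: fconnect_iter.
Qed.

Lemma anc_comparable u v w : anc u w -> anc v w -> anc u v || anc v u.
Proof.
move=> /ancP[i <-] /ancP[j <-].
wlog ij : i j / i <= j.
  by move=> wl; case/orP: (leq_total i j) => /wl //; rewrite orbC.
by rewrite -(subnK ij) iterD orbC /anc fconnect_iter.
Qed.

Lemma child_towards y x : anc y x -> y != x ->
  exists z, [/\ anc z x, par z = y & z != r].
Proof.
move=> /ancP[j]; elim: j x => [|j IH] x /=; first by move=> ->; rewrite eqxx.
rewrite -iterS iterSr => jx yx; have [yp|yp] := eqVneq y (par x).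
  exists x; rewrite anc_refl yp; split=> //; apply: contra_neq yx => xr.
  by rewrite yp xr par_root.
have [z [zx zy zr]] := IH _ jx yp; exists z; split=> //.
exact: anc_trans zx (anc_par x).
Qed.

Lemma descendant_ind (P : T -> Prop) :
  (forall v, (forall u, anc v u -> u != v -> P u) -> P v) -> forall v, P v.
Proof.
move=> IH v; move: {2}_.+1 (ltnSn #|[set w | anc v w]|) => n.
elim: n v => // n IHn v ltn; apply: IH => u vu uv; apply: IHn.
apply: (@leq_trans #|[set w | anc v w]|) => //; apply: proper_card.
apply/properP; split; first by apply/subsetP=> w; rewrite !inE; apply: anc_trans.
exists v; rewrite !inE ?anc_refl //; apply: contraNN uv => /anc_anti -> //.
Qed.

Section DFS.
Variable e : rel T.
Hypothesis e_sym : symmetric e.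
Hypothesis e_dfs : forall u v, e u v -> ancestor par u v \/ ancestor par v u.
Hypothesis conn2 : forall x u w : T, u != x -> w != x -> connect (del_vertex e x) u w.
Hypothesis gt2 : 2 < #|T|.

(** A path from [v] to [w] avoiding [par v] leaves the subtree of [v]; by the depth-first property
    it does so towards an ancestor of [v]. *)
Lemma leaving_edge v w : v != r -> w != par v -> ~~ anc v w ->
  exists x y, [/\ e x y, anc v x, anc y v, y != v & y != par v].
Proof.
move=> vr wp vw; have vp : v != par v by rewrite eq_sym par_neq.
have /connectP[q pq wl] := conn2 vp wp; move: pq wl (anc_refl v); set goal := (X in _ -> _ -> _ -> X).
suff walk x : path (del_vertex e (par v)) x q -> w = last x q -> anc v x -> goal by exact: walk.
elim: q x => [|y q IH] x /=; first by move=> _ wx vx; rewrite wx vx in vw.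
case/andP=> /and3P[exy xp yp] pq wl vx.
have [vy|vy] := boolP (anc v y); first exact: IH pq wl vy.
exists x, y; split=> //; last by apply: contraNneq vy => ->; apply: anc_refl.
case: (e_dfs exy) => /ancP xy; first by rewrite (anc_trans vx xy) in vy.
by have := anc_comparable vx xy; rewrite (negPf vy).
Qed.

(** With a second child of the root, an edge leaving the subtree of [v1] would have to reach a
    proper ancestor of [v1] other than [r]. *)
Lemma root_child : exists v1, [/\ v1 != r, par v1 = r & forall v, v != r -> anc v1 v].
Proof.
have [v vr] : exists v, v != r.
  have : 0 < #|[set~ r]| by rewrite cardsC1; move: gt2; clear; lia.
  by rewrite card_gt0 => /set0Pn[v]; rewrite !inE; exists v.
have rv : r != v by rewrite eq_sym.
have [v1 [_ v1r v1nr]] := child_towards (anc_root v) rv.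
exists v1; split=> // u ur; have ru : r != u by rewrite eq_sym.
have [z [zu zr znr]] := child_towards (anc_root u) ru.
have [<- //|zv1] := eqVneq z v1.
have [||x [y [_ _ yv1 ynv1]]] := @leaving_edge v1 z v1nr.
- by rewrite v1r.
- apply: contraNN v1nr => v1z; apply/eqP/anc_of_root; rewrite -zr.
  by apply: anc_proper; rewrite // eq_sym.
by rewrite v1r => /eqP []; apply: anc_of_root; rewrite -v1r anc_proper.
Qed.

(* The pair [(x, z)] stands for the back edge from [x] to the parent of its
   ancestor [z]; thus distinct second components mean distinct tree edges
   [z -- par z] to be paired with. *)
Definition is_ear (b : T * T) : bool := [&& b.2 != r, anc b.2 b.1 & e b.1 (par b.2)].

(** The ear bypasses the tree edge [v -- par v] even when shortened to end at [b.2], so pairing does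
    not spoil the cover. *)
Definition covers (b : T * T) (v : T) : bool := [&& anc v b.1, anc b.2 v & b.2 != v].

(** The topmost tree edge is excluded: no ear ends strictly above the root. *)
Definition deep (v : T) : bool := (v != r) && (par v != r).

Definition ear_cover (M : {set T * T}) : bool :=
  (M \subset is_ear) && [forall (v | deep v), exists b in M, covers b v].

Lemma all_ears_cover : ear_cover [set b | is_ear b].
Proof.
apply/andP; split; first by apply/subsetP=> b; rewrite inE.
apply/forall_inP=> v /andP[vr pvr]; apply/exists_inP.
have [||x [y [exy vx yv ynv ynp]]] := @leaving_edge v r vr.
- by rewrite eq_sym.
- by apply: contraNN vr => /anc_of_root->.
have yx : y != x.
  by apply: contraNneq ynv => yx; apply/eqP/anc_anti => //; rewrite yx.
have [z [zx zy zr]] := child_towards (anc_trans yv vx) yx.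
exists (x, z); first by rewrite inE /is_ear /= zr zx zy.
rewrite /covers /= vx /=.
have zv : z != v by apply: contra_neq ynp => <-.
rewrite zv andbT; have := anc_comparable zx vx; case/orP=> // vz.
by case/negP: ynv; apply/eqP/anc_anti => //; rewrite -zy; apply: anc_proper; rewrite // eq_sym.
Qed.

(** * Minimal covers and private tree edges *)

Section MinimalCover.
Variable M : {set T * T}.
Hypothesis minM : minset ear_cover M.

Let M_ear b : b \in M -> is_ear b.
Proof. by have /andP[/subsetP Me _] := minsetp minM; apply: Me. Qed.

Let M_cover v : deep v -> exists2 b, b \in M & covers b v.
Proof. by have /andP[_ /forall_inP Mc] := minsetp minM; move/Mc/exists_inP. Qed.

Lemma private_exists b : b \in M ->
  exists v, covers b v && [forall b' in M, covers b' v ==> (b' == b)].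
Proof.
move=> bM; have : ~~ ear_cover (M :\ b).
  apply/negP=> cov; have [_ /(_ _ cov (subD1set _ _)) Mb] := minsetP minM.
  by move: bM; rewrite -Mb setD11.
rewrite negb_and; have -> /= : M :\ b \subset is_ear.
  by apply/subsetP=> b' /setD1P[_ /M_ear].
rewrite negb_forall_in => /exists_inP[v dv]; rewrite negb_exists_in => /forall_inP none.
have only b' : b' \in M -> covers b' v -> b' == b.
  move=> b'M; apply: contraTT => b'b; apply: none; by rewrite in_setD1 b'b.
exists v; apply/andP; split; last first.
  by apply/forall_inP=> b' b'M; apply/implyP; apply: only.
by have [b' b'M b'v] := M_cover dv; rewrite -(eqP (only _ b'M b'v)).
Qed.

(** For members of [M] the default [b.1] is never taken. *)
Definition private (b : T * T) : T :=
  odflt b.1 [pick v | covers b v && [forall b' in M, covers b' v ==> (b' == b)]].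

Lemma private_covers b : b \in M -> covers b (private b).
Proof.
rewrite /private => /private_exists[v0 P0].
by case: pickP => [v /andP[] //|/(_ v0)]; rewrite P0.
Qed.

Lemma private_unique b b' : b \in M -> b' \in M -> covers b' (private b) -> b' = b.
Proof.
rewrite /private => /private_exists[v0 P0] b'M.
case: pickP => [v /andP[_ /forall_inP/(_ _ b'M)/implyP h] /h/eqP //|/(_ v0)].
by rewrite P0.
Qed.

Lemma private_nested b b0 : b \in M -> b0 \in M -> anc (private b) (private b0) ->
  anc b0.2 (private b) -> b0.2 != private b -> b0 = b.
Proof.
move=> bM b0M pp0 zp zp'; apply: private_unique => //; rewrite /covers zp zp' !andbT.
by have /and3P[+ _ _] := private_covers b0M; apply: anc_trans.
Qed.

(** One ear singled out among those competing for the tree edge [z -- par z]. *)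
Definition rep (z : T) : option (T * T) := [pick b in M | b.2 == z].

Lemma rep_some z b : rep z = Some b -> b \in M /\ b.2 = z.
Proof. by rewrite /rep; case: pickP => // b' /andP[bM /eqP bz] [<-]. Qed.

Lemma rep_exists b : b \in M -> exists b', rep b.2 = Some b'.
Proof.
by move=> bM; rewrite /rep; case: pickP => [b' _|/(_ b)]; [exists b'|rewrite bM eqxx].
Qed.

(** Walk down from [x]: where a representative exists, jump to its private vertex, otherwise step to
    any child. *)
Lemma leaf_below x : exists l, [/\ l \in leaves r par, anc x l &
  forall b, b \in M -> anc x b.2 -> anc (private b) l -> rep b.2 = Some b].
Proof.
elim/descendant_ind: x => x IH.
have priv_neq b : b \in M -> anc b.2 (private b) /\ b.2 != private b.
  by move=> /private_covers/and3P[].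
case rx: (rep x) => [b0|].
  have [b0M b0x] := rep_some rx.
  have [xp0 xnp0] := priv_neq _ b0M; rewrite b0x in xp0 xnp0.
  have [|l [l_leaf p0l IHl]] := IH _ xp0; first by rewrite eq_sym.
  exists l; split=> //; first exact: anc_trans xp0 p0l.
  move=> b bM xb pl; have [zp znp] := priv_neq _ bM.
  have xp : anc x (private b) by apply: anc_trans zp.
  have xnp : x != private b.
    apply: contraNneq znp => xp'; apply/eqP/anc_anti => //; by rewrite -xp'.
  (* If [private b] is the upper one, [b0] covers it. Otherwise either [b.2] lies below [private b0]
     and induction applies, or [b] covers [private b0]. *)
  case/orP: (anc_comparable pl p0l) => [pp0|p0p].
    by have <- : b0 = b; [apply: private_nested; rewrite ?b0x|rewrite b0x].
  have [p0z|] := boolP (anc (private b0) b.2); first exact: IHl.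
  have /orP[zp0 np0z|-> //] := anc_comparable (anc_trans zp pl) p0l.
  have -> : b = b0; last by rewrite b0x.
  apply: private_nested => //; apply: contraNneq np0z => ->; exact: anc_refl.
case: (pickP [pred c | (par c == x) && (c != r)]) => [c /= /andP[/eqP cx cr]|no_child].
  have [||l [l_leaf cl IHl]] := IH c; first by rewrite -cx anc_par.
    by rewrite -cx eq_sym par_neq.
  exists l; split=> //; first by apply: anc_trans cl; rewrite -cx anc_par.
  move=> b bM xb pl; apply: IHl => //; have [zp znp] := priv_neq _ bM.
  have /orP[bc|//] := anc_comparable (anc_trans zp pl) cl.
  have [-> |bnc] := eqVneq b.2 c; first exact: anc_refl.
  have bx : b.2 = x by apply: anc_anti => //; rewrite -cx anc_proper.
  by have [b' ] := rep_exists bM; rewrite bx rx.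
exists x; split; rewrite ?anc_refl //.
  rewrite inE; apply/forall_inP=> c cr; have := no_child c; by rewrite /= cr andbT => /negbT.
move=> b bM xb px; have [zp /eqP[]] := priv_neq _ bM.
by apply: anc_anti zp (anc_trans px xb).
Qed.

(* Ears that are not the representative of their second component inject into
   the leaves, and the leaf below the child of the root is not hit. *)
Lemma card_nonrep v1 : (forall v, v != r -> anc v1 v) ->
  #|[set b in M | rep b.2 != Some b]| < #|leaves r par|.
Proof.
move=> v1_anc; have [l lP] := fin_all_exists leaf_below.
set N0 := [set b in M | _].
have ear_v1 b : b \in M -> anc v1 b.2 by move=> /M_ear/and3P[/v1_anc].
have privl b : anc (private b) (l (private b)) by have [] := lP (private b).
(* Either [b'.2] lies below [private b], and the choice of the leaf makes [b'] a representative, or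
   [b'] covers [private b]. *)
have nested b b' : b \in N0 -> b' \in N0 -> l (private b) = l (private b') ->
    anc (private b) (private b') -> b = b'.
  rewrite !inE => /andP[bM _] /andP[b'M b'rep] ll pp.
  have /and3P[_ zp _] := private_covers b'M.
  have [pz|npz] := boolP (anc (private b) b'.2).
    have [_ _ /(_ b' b'M pz)] := lP (private b).
    by rewrite ll => /(_ (privl _)) b'r; rewrite b'r eqxx in b'rep.
  have /orP[zp'|] := anc_comparable zp pp; last by rewrite (negPf npz).
  apply/esym/private_nested => //; apply: contraNneq npz => ->; exact: anc_refl.
have inj : {in N0 &, injective (fun b => l (private b))}.
  move=> b b' bN b'N ll; have := privl b'; rewrite -ll => p'l.
  by case/orP: (anc_comparable (privl b) p'l) => pp; [|apply/esym]; apply: nested.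
rewrite -(card_in_imset inj); apply: proper_card; apply/properP; split.
  by apply/subsetP=> _ /imsetP[b _ ->]; have [] := lP (private b).
exists (l v1); first by have [] := lP v1.
apply/imsetP=> [[b]]; rewrite inE => /andP[bM brep] ll.
have [_ _ /(_ b bM (ear_v1 b bM))] := lP v1.
by rewrite ll => /(_ (privl b)) br; rewrite br eqxx in brep.
Qed.

End MinimalCover.

Definition landing (N : {set T * T}) (b : T * T) : T := if b \in N then par b.2 else b.2.

(** No ear covers the top edge [v1 -- r], so a representative [b2] at [v1] is also left unpaired;
    the strict bound of [card_nonrep] pays for it. *)
Lemma ear_system : exists M N : {set T * T},
  [/\ [/\ N \subset M, M \subset is_ear & #|N| <= #|leaves r par|],
      {in M :\: N &, injective snd} &
      forall v, v != r -> exists2 b, b \in M &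
        [&& anc v b.1, anc (landing N b) v & landing N b != v]].
Proof.
have [M minM _] := minset_exists (P := ear_cover) all_ears_cover.
have [v1 [v1r v1p v1_anc]] := root_child.
have /andP[/subsetP M_ear /forall_inP M_cover] := minsetp minM.
(* The ear covering a child of [v1] can only have [v1] as its second component. *)
have [b1 b1M b1v] : exists2 b, b \in M & b.2 = v1.
  have [u ur uv1] : exists2 u, u != r & u != v1.
    have : 0 < #|~: [set r; v1]|.
      by have := cardsC [set r; v1]; rewrite cards2; move: gt2; case: (r != v1); clear; lia.
    by rewrite card_gt0 => /set0Pn[u]; rewrite !inE negb_or => /andP[]; exists u.
  have v1u : v1 != u by rewrite eq_sym.
  have [c [_ cv1 cr]] := child_towards (v1_anc _ ur) v1u.
  have /exists_inP[b bM /and3P[_ bc bnc]] : [exists b in M, covers b c].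
    by apply: M_cover; rewrite /deep cr cv1.
  exists b => //; have /and3P[br _ _] := M_ear _ bM.
  by apply: anc_anti (v1_anc _ br); rewrite -cv1; apply: anc_proper.
have [b2 rep2] := rep_exists b1M; rewrite b1v in rep2.
have [b2M b2v] := rep_some rep2.
exists M, (b2 |: [set b in M | rep M b.2 != Some b]); split.
- split; last by apply: leq_trans (card_nonrep minM v1_anc); rewrite cardsU1; case: (_ \notin _).
    by apply/subsetP=> b; rewrite !inE => /orP[/eqP->|/andP[]].
  exact/subsetP.
- move=> b b'; rewrite !inE => /andP[nb bM] /andP[nb' b'M] bb'.
  move: nb nb'; rewrite !negb_or bM b'M !negbK => /andP[_ /eqP rb] /andP[_ /eqP].
  by rewrite -bb' rb => -[].
move=> v vr; have [pvr|pvr] := eqVneq (par v) r.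
  have v1E : v = v1.
    have [//|vv1] := eqVneq v v1; case/negP: v1r; apply/eqP/anc_of_root; rewrite -pvr.
    by apply: anc_proper; rewrite ?v1_anc // eq_sym.
  exists b2 => //; rewrite /landing !inE eqxx b2v v1E v1p anc_root eq_sym v1r !andbT.
  by have /and3P[_] := M_ear _ b2M; rewrite b2v.
have /exists_inP[b bM /and3P[vb bv bnv]] : [exists b in M, covers b v].
  by apply: M_cover; rewrite /deep vr.
exists b; rewrite // vb /landing; case: ifP => _ /=; last by rewrite bv.
rewrite (anc_trans (anc_par _) bv) /=; apply: contra_neq bnv => pb.
by apply: anc_anti => //; rewrite -pb anc_par.
Qed.

End DFS.
End Tree.

(** * The tour *)

Section Tour.
Variables (T : finType) (e : rel T) (r : T) (par : T -> T).
Hypotheses (e_irr : irreflexive e) (e_sym : symmetric e).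
Hypotheses (par_root : par r = r) (root_anc : forall v, ancestor par r v).
Hypothesis par_edge : forall v, v != r -> e v (par v).
Notation anc := (anc par).

Variables M N : {set T * T}.
Hypotheses (NM : N \subset M) (M_ear : M \subset is_ear r par e).
Hypothesis snd_inj : {in M :\: N &, injective snd}.
Hypothesis M_cover : forall v, v != r -> exists2 b, b \in M &
  [&& anc v b.1, anc (landing par N b) v & landing par N b != v].

(* Tree edges and ears as one multigraph on [T].  A paired ear [(x, z)] lands
   at [z] instead of [par z]: this subdivides the tree edge [z -- par z] by the
   end of the ear and contracts the lower half.  Pairs outside [M] are loops. *)
Definition end1 (f : T + T * T) : T := match f with inl v => v | inr b => b.1 end.
Definition end2 (f : T + T * T) : T :=
  match f with inl v => par v | inr b => if b \in M then landing par N b else b.1 end.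

Notation cutM := (cut end1 end2).

Lemma same_side (U : {set T}) x y : anc y x ->
  (forall v, anc v x -> anc y v -> v != y -> inl v \notin cutM U) ->
  (x \in U) = (y \in U).
Proof.
case/ancP=> j; elim: j x => [|j IH] x; first by move=> /= ->.
rewrite iterSr => jx none; have [-> //|xy] := eqVneq x y.
have yx : anc y x by apply/ancP; exists j.+1; rewrite iterSr.
transitivity (par x \in U).
  have := none x (anc_refl _ _) yx xy; rewrite inE /=.
  by case: (x \in U); case: (_ \in U).
by apply: IH jx _ => v vx; apply: none; apply: anc_trans vx (anc_par _ _).
Qed.

Lemma landing_anc b : b \in M -> anc (landing par N b) b.1.
Proof.
move=> /(subsetP M_ear)/and3P[_ zx _]; rewrite /landing.
by case: ifP => // _; apply: anc_trans (anc_par _ _) zx.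
Qed.

(** A tree edge is bypassed by an ear, an ear by its tree path, and [inl r] is a loop. *)
Lemma tour_graph_bridgeless (U : {set T}) : #|cutM U| != 1.
Proof.
apply/cards1P=> [[f cutE]].
have in_cut g : (g \in cutM U) = (g == f) by rewrite cutE inE.
have fU : f \in cutM U by rewrite in_cut.
case: f in_cut fU {cutE} => [v|b] in_cut; rewrite inE /=.
- have [->|vr] := eqVneq v r; first by rewrite par_root addbb.
  have [b bM /and3P[vb bv bnv]] := M_cover vr.
  have bU : (b.1 \in U) = (landing par N b \in U).
    have : inr b \notin cutM U by rewrite in_cut.
    by rewrite inE /= bM; case: (_ \in U); case: (_ \in U).
  have vU : (b.1 \in U) = (v \in U).
    by apply: same_side => // u _ _ uv; rewrite in_cut.
  have pU : (par v \in U) = (landing par N b \in U).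
    apply: same_side; first exact: anc_proper.
    move=> u up _ _; rewrite in_cut; apply: contraTneq up => -[->].
    apply: contra (par_neq par_root root_anc vr) => vp; apply/eqP.
    by apply: (anc_anti par_root root_anc) => //; apply: anc_par.
  by rewrite -vU pU -bU addbb.
- case: ifP => [bM|_]; last by rewrite addbb.
  rewrite (same_side (landing_anc bM)) ?addbb // => u _ _ _.
  by rewrite in_cut.
Qed.

(** * From an even subgraph to a connected even multigraph *)

Section EvenSubgraph.
Variable F : {set T + T * T}.
Hypothesis evenF : boundary end1 end2 F = set0.

Let single := [set v | (v != r) && (inl v \notin F)].
Let kept := [set b in M | inr b \in F].
Let kept_paired := kept :\: N.
Let double := [set v | (v != r) && (v \notin snd @: kept_paired)].

(* A tree edge occurs twice, less one if it is in [F], less one if the ear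
   paired with it is in [F]. *)
Definition tour_edges : seq (T * T) :=
  [seq (v, par v) | v <- enum single] ++ [seq (v, par v) | v <- enum double] ++
  [seq (b.1, par b.2) | b <- enum kept].

Let paired_inj : {in kept_paired &, injective snd}.
Proof.
by move=> b b' /setDP[+ bN] /setDP[+ b'N]; rewrite !inE => /andP[bM _] /andP[b'M _];
  apply: snd_inj; rewrite inE ?bN ?b'N.
Qed.

Lemma tour_edges_edge : edge_seq e tour_edges.
Proof.
rewrite /edge_seq !all_cat; apply/and3P; split; apply/allP=> _ /mapP[x + ->];
  rewrite mem_enum inE => /andP[] /=.
- by move=> /par_edge.
- by move=> /par_edge.
- by move=> /(subsetP M_ear)/and3P[].
Qed.

(** Modulo 2 the two copies of the tree cancel. A kept paired ear together with its dropped tree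
    edge amounts to an edge landing at [b.2], so what remains is the degree in [F]. *)
Lemma tour_edges_even q : odd_degree tour_edges q = false.
Proof.
pose inc v := (v == q) (+) (par v == q).
have inc_r : inc r = false by rewrite /inc par_root addbb.
rewrite !odd_degree_cat /odd_degree !big_map !big_enum /=.
have -> : \big[addb/false]_(v in single) inc v =
    \big[addb/false]_v inc v (+) \big[addb/false]_v ((inl v \in F) && inc v).
  rewrite -big_split big_mkcond; apply: eq_bigr => v _; rewrite inE /=.
  by have [->|_] := eqVneq v r; rewrite ?inc_r ?andbF //; case: (_ \in F); case: (inc v).
have -> : \big[addb/false]_(v in double) inc v =
    \big[addb/false]_v inc v (+) \big[addb/false]_(b in kept_paired) inc b.2.
  rewrite -(big_imset inc paired_inj) [X in _ (+) X]big_mkcond -big_split big_mkcond.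
  apply: eq_bigr => v _; rewrite inE /=.
  have [->|_] := eqVneq v r; first by rewrite inc_r; case: ifP.
  by case: (_ \in _ @: _); case: (inc v).
have evenFq : \big[addb/false]_v ((inl v \in F) && inc v) (+)
    \big[addb/false]_b ((inr b \in F) && incident end1 end2 (inr b) q) = false.
  have /setP/(_ q) := evenF; rewrite !inE big_mkcond big_sumType /= => evenFq; apply: etrans evenFq.
  by congr (_ (+) _); apply: eq_bigr => x _; case: (_ \in F).
have -> : \big[addb/false]_(b in kept) ((b.1 == q) (+) (par b.2 == q)) =
    \big[addb/false]_(b in kept_paired) inc b.2 (+)
    \big[addb/false]_b ((inr b \in F) && incident end1 end2 (inr b) q).
  rewrite !(big_mkcond (fun b => b \in _)) -big_split; apply: eq_bigr => b _.
  rewrite !inE /incident /= /landing /inc; case: (b \in M) => /=; last first.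
    by rewrite addbb !andbF.
  by case: (inr b \in F); case: (b \in N); rewrite //=; case: (_ == q); case: (_ == q); case: (_ == q).
move: evenFq; set x1 := \big[addb/false]_v inc v; set x2 := \big[addb/false]_v (_ && _).
set x3 := \big[addb/false]_b (_ && _); set x4 := \big[addb/false]_(b in kept_paired) _.
by case: x1; case: x2; case: x3; case: x4.
Qed.

(** Induction from below: if both copies of [c -- par c] are gone, the ear paired with it leads from
    [par c] into the connected subtree of [c]. *)
Lemma tour_edges_connected v : connect (seq_adj tour_edges) r v.
Proof.
have adj_sym : symmetric (seq_adj tour_edges) by move=> x y; rewrite /seq_adj orbC.
have tree c : c \in single :|: double -> connect (seq_adj tour_edges) (par c) c.
  rewrite inE => cs; apply: connect1; apply/orP; right; rewrite !mem_cat.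
  by case/orP: cs => cs; apply/or3P; [apply: Or31|apply: Or32]; apply: map_f; rewrite mem_enum.
suff below u : forall x, anc u x -> connect (seq_adj tour_edges) u x.
  exact: below (anc_root root_anc v).
elim/(descendant_ind par_root root_anc): u => u IH x ux.
have [->|nux] := eqVneq u x; first exact: connect0.
have [c [cx cu cr]] := child_towards par_root ux nux.
have [uc cnu] : anc u c /\ c != u.
  by rewrite -cu anc_par eq_sym (par_neq par_root root_anc).
apply: connect_trans (IH c uc cnu x cx); rewrite -cu.
have [/tree //|] := boolP (c \in single :|: double).
rewrite !inE cr negb_or !negbK => /andP[_ /imsetP[b bP cb]].
have /setDP[bK _] := bP; have bM : b \in M by move: bK; rewrite inE => /andP[].
have /and3P[_ cb1 _] := subsetP M_ear _ bM.
apply: (@connect_trans _ _ b.1).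
  apply: connect1; apply/orP; right; rewrite !mem_cat cb; apply/or3P/Or33.
  by apply: map_f; rewrite mem_enum.
by rewrite (sym_connect_sym adj_sym); apply: IH => //; rewrite cb.
Qed.

Lemma size_tour_edges :
  size tour_edges = #|single| + #|T|.-1 + #|[set b in N | inr b \in F]|.
Proof.
rewrite !size_cat !size_map -!cardE.
have nonroot : #|[set~ r]| = #|T|.-1 by rewrite cardsC1.
rewrite -nonroot; have <- : #|double| + #|kept_paired| = #|[set~ r]|.
  rewrite -(card_in_imset paired_inj) -(cardsID (snd @: kept_paired) [set~ r]) addnC.
  congr (_ + _); apply: eq_card => v; rewrite !inE; last by rewrite andbC.
  rewrite andb_idl // => /imsetP[b /setDP[bK _] ->].
  by move: bK; rewrite inE => /andP[/(subsetP M_ear)/and3P[]].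
have -> : #|kept| = #|kept_paired| + #|[set b in N | inr b \in F]|.
  rewrite -(cardsID N kept) addnC; congr (_ + _); apply: eq_card => b; rewrite !inE.
  by case bN: (b \in N); rewrite ?andbF // (subsetP NM) // andbT.
by rewrite !addnA.
Qed.

End EvenSubgraph.

Lemma short_tour : exists p, tsp_tour e r p /\ 3 * size p <= 4 * #|T| + 2 * #|N|.
Proof.
(* Only omitted non-root tree edges and used unpaired ears cost anything. *)
pose w (f : T + T * T) : nat := match f with inl v => v != r | inr b => b \in N end.
pose NN : {set T + T * T} := inr @: N.
have [F evenF wF] := heavy_even_subgraph NN w tour_graph_bridgeless.
have [p [pp lp sp p_all]] := euler_tour e_irr e_sym (tour_edges_edge F)
  (tour_edges_even evenF) (tour_edges_connected F).
exists p; split; first by split.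
have inlN v : (inl v \in NN) = false.
  by apply/imsetP=> [[b _]].
have inrN b : (inr b \in NN) = (b \in N).
  by rewrite mem_imset // => x y [].
have sumE (A : {set T + T * T}) : \sum_(f in A) w f =
    #|[set v | (v != r) && (inl v \in A)]| + #|[set b in N | inr b \in A]|.
  rewrite big_mkcond big_sumType -!sum1_card !(big_mkcond (fun x => x \in _)) /=.
  congr (_ + _); apply: eq_bigr => x _; rewrite inE.
    by case: (_ \in A); rewrite ?andbF ?andbT //; case: (_ != _).
  by case: (_ \in A); rewrite ?andbF ?andbT //; case: (_ \in N).
move: wF; rewrite !sumE sp size_tour_edges.
have -> : [set v | (v != r) && (inl v \in ~: NN :\: F)] = [set v | (v != r) && (inl v \notin F)].
  by apply/setP=> v; rewrite !inE inlN andbT.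
have -> : [set b in N | inr b \in NN :&: F] = [set b in N | inr b \in F].
  by apply/setP=> b; rewrite !inE inrN; case: (b \in N).
have -> : [set v | (v != r) && (inl v \in ~: NN)] = [set~ r].
  by apply/setP=> v; rewrite !inE inlN andbT.
have -> : [set b in N | inr b \in ~: NN] = set0.
  by apply/setP=> b; rewrite !inE inrN andbN.
have -> : [set v | (v != r) && (inl v \in NN)] = set0.
  by apply/setP=> v; rewrite !inE inlN andbF.
have -> : [set b in N | inr b \in NN] = N.
  by apply/setP=> b; rewrite !inE inrN andbb.
rewrite cardsC1 !cards0; move: #|[set v | _ & _ \notin _]|.
by move: #|[set b in N | inr b \in F]| #|N| #|T|; clear; lia.
Qed.
End Tour.

Theorem theorem8 (T : finType) (e : rel T) (k : nat) :
  simple_graph e -> two_vertex_connected e ->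
  (exists (r : T) (par : T -> T), dfs_tree e r par /\ #|leaves r par| <= k) ->
  exists (x0 : T) (p : seq T), tsp_tour e x0 p /\ 3 * size p <= 4 * #|T| + 2 * k.
Proof.
move=> [e_irr e_sym] [gt2 [_ conn2]] [r [par [[[par_root [par_edge root_anc]] e_dfs] leaves_k]]].
have [M [N [[NM M_ear N_leaves] snd_inj M_cover]]] :=
  ear_system par_root root_anc e_dfs conn2 gt2.
have [p [p_tour sp]] :=
  short_tour e_irr e_sym par_root root_anc par_edge NM M_ear snd_inj M_cover.
exists r, p; split=> //; apply: leq_trans sp _.
by rewrite leq_add2l leq_mul2l (leq_trans N_leaves leaves_k).
Qed.
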